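(* Let $(X,d)$ be a compact metric space and let $f:X\to X$ be a continuous map such that (1) $f$ has the limit shadowing property, and (2) $h_{top}(f)>0$. Then $f$ exhibits distributional chaos of type 1 (DC1). Moreover, $E(X,f)\subset\overline{DC1(X,f)}$, where the closure is taken in $X^2$.
   Context: A sequence $(x_i)_{i\ge0}$ in $X$ is a limit pseudo orbit of $f$ if $\lim_{i\to\infty}d(f(x_i),x_{i+1})=0$; $f$ has the limit shadowing property if for every limit pseudo orbit $(x_i)_{i\ge0}$ there is $x\in X$ with $\lim_{i\to\infty}d(f^i(x),x_i)=0$. $h_{top}(f)$ is the topological entropy. For an open cover $\mathcal U$, $h(f,\mathcal U)$ is the entropy of $f$ relative to $\mathcal U$. A pair $(x,y)\in X^2$ with $x\ne y$ is an entropy pair if for all closed neighborhoods $A$ of $x$ and $B$ of $y$ with $A\cap B=\emptyset$, $h(f,\{X\setminus A,X\setminus B\})>0$; $E(X,f)$ is the set of entropy pairs. A pair $(x,y)\in X^2$ is a DC1-pair for $f$ if $\limsup_{n\to\infty}\frac1n|\{0\le i\le n-1: d(f^i(x),f^i(y))<\delta\}|=1$ for every $\delta>0$, and $\limsup_{n\to\infty}\frac1n|\{0\le i\le n-1: d(f^i(x),f^i(y))>\delta_0\}|=1$ for some $\delta_0>0$; $DC1(X,f)$ is the set of DC1-pairs. $f$ exhibits DC1 if there is an uncountable $S\subset X$ such that every $(x,y)$ with $x,y\in S$, $x\neq y$, is a DC1-pair. *)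

(* Defs.v *)
From Stdlib Require Import Reals Lra List Classical.
Open Scope R_scope.

Definition is_metric {X : Type} (d : X -> X -> R) : Prop :=
  (forall x y, 0 <= d x y) /\
  (forall x y, d x y = 0 <-> x = y) /\
  (forall x y, d x y = d y x) /\
  (forall x y z, d x z <= d x y + d y z).

Definition is_open {X : Type} (d : X -> X -> R) (V : X -> Prop) : Prop :=
  forall x, V x -> exists eps, 0 < eps /\ forall y, d x y < eps -> V y.

Definition is_closed {X : Type} (d : X -> X -> R) (A : X -> Prop) : Prop :=
  is_open d (fun x => ~ A x).

Definition is_nbhd {X : Type} (d : X -> X -> R) (A : X -> Prop) (x : X) : Prop :=
  exists eps, 0 < eps /\ forall y, d x y < eps -> A y.

Definition compact_space {X : Type} (d : X -> X -> R) : Prop :=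
  forall (I : Type) (V : I -> X -> Prop),
    (forall i, is_open d (V i)) -> (forall x, exists i, V i x) ->
    exists l : list I, forall x, exists i, In i l /\ V i x.

Definition continuous_map {X : Type} (d : X -> X -> R) (f : X -> X) : Prop :=
  forall x eps, 0 < eps -> exists delta, 0 < delta /\
    forall y, d x y < delta -> d (f x) (f y) < eps.

Definition limit_pseudo_orbit {X : Type} (d : X -> X -> R) (f : X -> X)
  (xs : nat -> X) : Prop :=
  Un_cv (fun i => d (f (xs i)) (xs (S i))) 0.

Definition limit_shadowing {X : Type} (d : X -> X -> R) (f : X -> X) : Prop :=
  forall xs : nat -> X, limit_pseudo_orbit d f xs ->
    exists x : X, Un_cv (fun i => d (Nat.iter i f x) (xs i)) 0.

Definition cmember {X : Type} (U : list (X -> Prop)) (k : nat) : X -> Prop :=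
  nth k U (fun _ => False).

Definition is_open_cover {X : Type} (d : X -> X -> R) (U : list (X -> Prop)) : Prop :=
  (forall V, In V U -> is_open d V) /\ (forall x, exists V, In V U /\ V x).

(** The member of the join U^n = U v f^{-1}U v ... v f^{-(n-1)}U indexed
    by the word [w] : it is the intersection over i<n of f^{-i}(U_{w i}). *)
Definition join_elem {X : Type} (f : X -> X) (U : list (X -> Prop)) (n : nat)
  (w : nat -> nat) : X -> Prop :=
  fun x => forall i, (i < n)%nat -> cmember U (w i) (Nat.iter i f x).

Definition covers_by_words {X : Type} (f : X -> X) (U : list (X -> Prop)) (n : nat)
  (ws : list (nat -> nat)) : Prop :=
  forall x, exists w, In w ws /\ join_elem f U n w x.

Definition cover_number {X : Type} (f : X -> X) (U : list (X -> Prop)) (n k : nat) : Prop :=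
  (exists ws, covers_by_words f U n ws /\ length ws = k) /\
  (forall ws, covers_by_words f U n ws -> (k <= length ws)%nat).

Definition cover_entropy_is {X : Type} (f : X -> X) (U : list (X -> Prop)) (l : R) : Prop :=
  exists N : nat -> nat, (forall n, cover_number f U n (N n)) /\
    Un_cv (fun n => ln (INR (N (S n))) / INR (S n)) l.

Definition cover_entropy_pos {X : Type} (f : X -> X) (U : list (X -> Prop)) : Prop :=
  exists l, 0 < l /\ cover_entropy_is f U l.

(** h_top(f) = sup over finite open covers U of h(f,U); hence
    h_top(f) > 0 iff some finite open cover has positive entropy. *)
Definition htop_pos {X : Type} (d : X -> X -> R) (f : X -> X) : Prop :=
  exists U, is_open_cover d U /\ cover_entropy_pos f U.

Definition entropy_pair {X : Type} (d : X -> X -> R) (f : X -> X) (x y : X) : Prop :=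
  x <> y /\
  forall A B : X -> Prop,
    is_closed d A -> is_nbhd d A x ->
    is_closed d B -> is_nbhd d B y ->
    (forall z, ~ (A z /\ B z)) ->
    cover_entropy_pos f ((fun z => ~ A z) :: (fun z => ~ B z) :: nil).

Fixpoint count_upto (P : nat -> bool) (n : nat) : nat :=
  match n with
  | O => O
  | S m => (count_upto P m + (if P m then 1 else 0))%nat
  end.

Definition Rltb (a b : R) : bool := if Rlt_dec a b then true else false.

Definition limsup_is_one (u : nat -> R) : Prop :=
  (forall eps, 0 < eps -> forall N, exists n, (N <= n)%nat /\ 1 - eps < u n) /\
  (forall eps, 0 < eps -> exists N, forall n, (N <= n)%nat -> u n < 1 + eps).

Definition DC1_pair {X : Type} (d : X -> X -> R) (f : X -> X) (x y : X) : Prop :=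
  (forall delta, 0 < delta ->
     limsup_is_one (fun n =>
       INR (count_upto (fun i => Rltb (d (Nat.iter i f x) (Nat.iter i f y)) delta) n)
       / INR n)) /\
  (exists delta0, 0 < delta0 /\
     limsup_is_one (fun n =>
       INR (count_upto (fun i => Rltb delta0 (d (Nat.iter i f x) (Nat.iter i f y))) n)
       / INR n)).

Definition uncountable {X : Type} (S : X -> Prop) : Prop :=
  ~ exists g : X -> nat, forall x y, S x -> S y -> g x = g y -> x = y.

Definition exhibits_DC1 {X : Type} (d : X -> X -> R) (f : X -> X) : Prop :=
  exists S : X -> Prop, uncountable S /\
    forall x y, S x -> S y -> x <> y -> DC1_pair d f x y.

Definition in_closure_DC1 {X : Type} (d : X -> X -> R) (f : X -> X) (x y : X) : Prop :=
  forall eps, 0 < eps -> exists u v, DC1_pair d f u v /\ d x u < eps /\ d y v < eps.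

(* Main.v *)
Require Import Defs.
From Stdlib Require Import Reals Lra List Classical.
From Stdlib Require Import Lia Arith IndefiniteDescription FunctionalExtensionality.
Open Scope R_scope.

(** Call a and b linked at scale eps if there are eps-chains a->a, a->b, b->a, b->b of one common
    length. If points linked at scale eps always share a member of an open cover U, then only polynomially
    many U-words are needed, because an orbit is cut into boundedly many loops through small cells and
    any two points at the same time of equally long loops at one cell are linked. Hence positive
    entropy yields distinct points x, y linked at every scale, and every entropy pair is such.
    Limit shadowing produces a point whose f^n-orbit follows an itinerary in {x, y} with
    arbitrarily long runs of either symbol; its limit points along the runs give a near x and b
    near y, again linked at all scales, whose orbits stay uniformly apart. Limit shadowing of
    concatenated runs along the orbits of a and b, each much longer than the past, gives a Cantor
    family of DC1 pairs that pass near (a, b) at common times. *)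

(** * Compactness in metric spaces through cluster points *)

Lemma inv_INR_S_pos (k : nat) : 0 < / INR (S k).
Proof. apply Rinv_0_lt_compat, lt_0_INR; lia. Qed.

Lemma inv_INR_S_lt (eps : R) : 0 < eps ->
  exists K, forall k, (K <= k)%nat -> / INR (S k) < eps.
Proof.
  intros He. destruct (archimed_cor1 eps He) as [N [HN HN0]].
  exists N. intros k Hk. apply Rle_lt_trans with (/ INR N); [|exact HN].
  apply Rinv_le_contravar; [apply lt_0_INR; lia | apply le_INR; lia].
Qed.

Section Metric.

Context {X : Type} {d : X -> X -> R} (Hd : is_metric d).

Lemma metric_nonneg x y : 0 <= d x y.
Proof. apply Hd. Qed.
Lemma metric_refl x : d x x = 0.
Proof. apply Hd; reflexivity. Qed.
Lemma metric_sym x y : d x y = d y x.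
Proof. apply Hd. Qed.
Lemma metric_tri x y z : d x z <= d x y + d y z.
Proof. apply Hd. Qed.
Lemma metric_pos x y : x <> y -> 0 < d x y.
Proof.
  intros H. destruct (metric_nonneg x y) as [H0|H0]; [exact H0|].
  exfalso; apply H, Hd; auto.
Qed.

Lemma is_open_ball c r : is_open d (fun x => d c x < r).
Proof.
  intros x Hx. exists (r - d c x). split; [lra|].
  intros y Hy. pose proof (metric_tri c x y). lra.
Qed.

Lemma is_closed_closed_ball c r : is_closed d (fun x => d c x <= r).
Proof.
  intros x Hx. exists (d c x - r). split; [lra|].
  intros y Hy Hle. pose proof (metric_tri c y x). rewrite (metric_sym y x) in H. lra.
Qed.

Lemma continuous_iter (f : X -> X) (n : nat) :
  continuous_map d f -> continuous_map d (Nat.iter n f).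
Proof.
  intros Hf. induction n as [|n IH]; intros x eps He; simpl.
  - exists eps. auto.
  - destruct (Hf (Nat.iter n f x) eps He) as [d1 [Hd1 H1]].
    destruct (IH x d1 Hd1) as [d2 [Hd2 H2]].
    exists d2. split; auto.
Qed.

Context (Hcpt : compact_space d).

Definition cluster_point (u : nat -> X) (x : X) : Prop :=
  forall eps N, 0 < eps -> exists n, (N <= n)%nat /\ d x (u n) < eps.

(** Otherwise every point is the centre of a ball that [u] eventually leaves for good. An index in
    [J] records centre, radius and leaving time; finitely many such balls cover the space, yet [u]
    at the largest leaving time lies in none of them. *)
Lemma cluster_point_exists (u : nat -> X) : exists x, cluster_point u x.
Proof.
  apply NNPP. intros Hno.
  pose (J := {p : X * R * nat | 0 < snd (fst p) /\
    forall n, (snd p <= n)%nat -> snd (fst p) <= d (fst (fst p)) (u n)}).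
  destruct (Hcpt J (fun j x => d (fst (fst (proj1_sig j))) x < snd (fst (proj1_sig j)))) as [l Hl].
  - intros j. apply is_open_ball.
  - intros x. apply NNPP. intros Hx. apply Hno. exists x.
    intros eps N He. apply NNPP. intros Hn. apply Hx.
    assert (HJ : 0 < snd (fst (x, eps, N)) /\
      forall n, (snd (x, eps, N) <= n)%nat -> snd (fst (x, eps, N)) <= d (fst (fst (x, eps, N))) (u n)).
    { simpl. split; [exact He|]. intros n Hle. apply Rnot_lt_le. intros Hlt. apply Hn. eauto. }
    exists (exist _ (x, eps, N) HJ). simpl. rewrite metric_refl. exact He.
  - assert (Hmax : exists M, forall j, In j l -> (snd (proj1_sig j) <= M)%nat).
    { clear Hl. induction l as [|j l [M HM]].
      - exists O. intros j [].
      - exists (Nat.max (snd (proj1_sig j)) M). intros j' [<-|Hj]; [lia|].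
        specialize (HM j' Hj). lia. }
    destruct Hmax as [M HM]. destruct (Hl (u M)) as [j [Hj Hlt]].
    pose proof (proj2 (proj2_sig j) M (HM j Hj)). lra.
Qed.

Lemma cluster_pair_exists (u v : nat -> X) : exists x y, forall eps N, 0 < eps ->
  exists n, (N <= n)%nat /\ d x (u n) < eps /\ d y (v n) < eps.
Proof.
  destruct (cluster_point_exists u) as [x Hx].
  assert (H : forall k, exists n, (k <= n)%nat /\ d x (u n) < / INR (S k)).
  { intros k. apply Hx, inv_INR_S_pos. }
  destruct (functional_choice _ H) as [phi Hphi].
  destruct (cluster_point_exists (fun k => v (phi k))) as [y Hy].
  exists x, y. intros eps N He. destruct (inv_INR_S_lt eps He) as [K HK].
  destruct (Hy eps (Nat.max N K) He) as [k [Hk Hk']].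
  destruct (Hphi k) as [H1 H2]. exists (phi k).
  specialize (HK k). split; [lia|]. split; [|exact Hk'].
  apply Rlt_trans with (/ INR (S k)); [exact H2 | apply HK; lia].
Qed.

Lemma uniformly_continuous (g : X -> X) : continuous_map d g ->
  forall eps, 0 < eps -> exists delta, 0 < delta /\
    forall x y, d x y < delta -> d (g x) (g y) < eps.
Proof.
  intros Hg eps He. apply NNPP. intros Hno.
  assert (H : forall k, exists p : X * X,
    d (fst p) (snd p) < / INR (S k) /\ eps <= d (g (fst p)) (g (snd p))).
  { intros k. apply NNPP. intros Hk. apply Hno. exists (/ INR (S k)).
    split; [apply inv_INR_S_pos|]. intros x y Hxy. apply Rnot_le_lt. intros Hle.
    apply Hk. exists (x, y). auto. }
  destruct (functional_choice _ H) as [p Hp].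
  destruct (cluster_point_exists (fun k => fst (p k))) as [x Hx].
  destruct (Hg x (eps / 2)) as [delta [Hdel Hc]]; [lra|].
  destruct (inv_INR_S_lt (delta / 2)) as [K HK]; [lra|].
  destruct (Hx (delta / 2) K) as [k [Hk Hk']]; [lra|].
  destruct (Hp k) as [H1 H2]. specialize (HK k Hk).
  assert (A1 : d (g x) (g (fst (p k))) < eps / 2) by (apply Hc; lra).
  assert (A2 : d (g x) (g (snd (p k))) < eps / 2).
  { apply Hc. pose proof (metric_tri x (fst (p k)) (snd (p k))). lra. }
  pose proof (metric_tri (g (fst (p k))) (g x) (g (snd (p k)))).
  rewrite (metric_sym (g (fst (p k))) (g x)) in H0. lra.
Qed.

(** An index beyond the end of [U] names the empty set under [cmember], so the [k] obtained is
    automatically the index of a true member. *)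
Lemma lebesgue_number (U : list (X -> Prop)) : is_open_cover d U ->
  exists lam, 0 < lam /\
    forall x, exists k, forall y, d x y < lam -> cmember U k y.
Proof.
  intros [HU Hc]. apply NNPP. intros Hno.
  assert (H : forall n, exists x, forall k, exists y,
    d x y < / INR (S n) /\ ~ cmember U k y).
  { intros n. apply NNPP. intros Hn. apply Hno. exists (/ INR (S n)).
    split; [apply inv_INR_S_pos|]. intros x. apply NNPP. intros Hx.
    apply Hn. exists x. intros k. apply NNPP. intros Hk. apply Hx. exists k.
    intros y Hy. apply NNPP. intros Hy'. apply Hk. eauto. }
  destruct (functional_choice _ H) as [u Hu].
  destruct (cluster_point_exists u) as [x Hx].
  destruct (Hc x) as [V [HV HVx]].
  destruct (HU V HV x HVx) as [eps [He Hball]].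
  destruct (In_nth U V (fun _ => False) HV) as [k [_ Hk]].
  destruct (inv_INR_S_lt (eps / 2)) as [K HK]; [lra|].
  destruct (Hx (eps / 2) K) as [n [Hn Hn']]; [lra|].
  destruct (Hu n k) as [y [Hy Hy']]. apply Hy'. unfold cmember. rewrite Hk.
  apply Hball. pose proof (metric_tri x (u n) y). specialize (HK n Hn). lra.
Qed.

Lemma finite_net (r : R) : 0 < r -> exists Z : list X, forall x, exists c, In c Z /\ d c x < r.
Proof.
  intros Hr. apply (Hcpt X (fun c x => d c x < r)).
  - intros c. apply is_open_ball.
  - intros x. exists x. rewrite metric_refl. exact Hr.
Qed.

End Metric.

(** * Counting the words needed to cover orbits that run through finitely many cells *)

Section Counting.

Context {X : Type} (f : X -> X) (U : list (X -> Prop)).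

(** A version of [covers_by_words] relative to a set [Q] and with a mere upper bound on the number
    of words, so that bounds add up over unions. *)
Definition coverable (Q : X -> Prop) (n m : nat) : Prop :=
  exists ws : list (nat -> nat), (length ws <= m)%nat /\
    forall x, Q x -> exists w, In w ws /\ join_elem f U n w x.

Lemma coverable_union {A : Type} (l : list A) (Q : A -> X -> Prop) (n m : nat) :
  (forall a, In a l -> coverable (Q a) n m) ->
  coverable (fun x => exists a, In a l /\ Q a x) n (length l * m).
Proof.
  induction l as [|a l IH]; intros H.
  - exists nil. split; [simpl; lia|]. intros x [a [[] _]].
  - destruct IH as [ws [Hlen Hws]]; [intros b Hb; apply H; right; exact Hb|].
    destruct (H a) as [ws' [Hlen' Hws']]; [left; reflexivity|].
    exists (ws' ++ ws). split; [rewrite length_app; simpl; lia|].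
    intros x [b [[<-|Hb] HQ]].
    + destruct (Hws' x HQ) as [w [Hw Hj]]. exists w. rewrite in_app_iff. auto.
    + destruct (Hws x) as [w [Hw Hj]]; [eauto|]. exists w. rewrite in_app_iff. auto.
Qed.

Lemma last_time (P : nat -> Prop) (n : nat) : (0 < n)%nat -> P 0%nat ->
  exists tau, (tau < n)%nat /\ P tau /\ forall i, (tau < i < n)%nat -> ~ P i.
Proof.
  intros Hn H0. induction n as [|n IH]; [lia|].
  destruct (classic (P n)) as [HP|HP].
  - exists n. split; [lia|]. split; [exact HP|]. intros i Hi. lia.
  - destruct n as [|n]; [contradiction|].
    destruct IH as [tau [H1 [H2 H3]]]; [lia|].
    exists tau. split; [lia|]. split; [exact H2|]. intros i Hi.
    destruct (Nat.eq_dec i (S n)) as [->|Hne]; [exact HP|]. apply H3. lia.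
Qed.

Context {I : Type} (V : I -> X -> Prop).

(* An orbit starting in the cell c is cut at its last visit to c: up to that time it is a
   loop, so its word is forced, and afterwards the orbit avoids c. *)
Lemma polynomially_many_words (C : nat) :
  (forall c l i, (i <= l)%nat -> exists k, forall x, V c x -> V c (Nat.iter l f x) ->
     cmember U k (Nat.iter i f x)) ->
  forall (Z : list I) (n : nat), (length Z <= C)%nat ->
    coverable (fun x => forall i, (i < n)%nat -> exists c, In c Z /\ V c (Nat.iter i f x))
      n ((C * S n) ^ length Z).
Proof.
  intros Hloop Z.
  remember (length Z) as N eqn:HN. revert Z HN.
  induction N as [|N IH]; intros Z HN n HC.
  (* Without cells every point qualifies for [n = 0], where one word suffices, and no point
     qualifies for [n > 0]. *)
  - destruct n as [|n].
    + exists ((fun _ => 0%nat) :: nil). split; [simpl; lia|].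
      intros x _. exists (fun _ => 0%nat). split; [left; reflexivity|]. intros i Hi. lia.
    + exists nil. split; [simpl; lia|]. intros x Hx.
      destruct (Hx 0%nat) as [c [Hc _]]; [lia|]. destruct Z; [destruct Hc|discriminate].
  - destruct n as [|n].
    { exists ((fun _ => 0%nat) :: nil). split.
      - simpl length. apply Nat.neq_0_lt_0, Nat.pow_nonzero. lia.
      - intros x _. exists (fun _ => 0%nat). split; [left; reflexivity|]. intros i Hi. lia. }
    set (n' := S n). set (m := ((C * S n') ^ N)%nat).
    (* [Q (c, tau)] collects the orbits that start in the cell [c] and visit it for the last time
       before [n'] at time [tau]. *)
    pose (Q := fun (ct : I * nat) x => (snd ct < n')%nat /\ V (fst ct) x /\
       V (fst ct) (Nat.iter (snd ct) f x) /\
       forall i, (snd ct < i < n')%nat -> exists c, In c Z /\ c <> fst ct /\ V c (Nat.iter i f x)).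
    assert (HQ : forall ct, In ct (list_prod Z (seq 0 n')) -> coverable (Q ct) n' m).
    { intros [c tau] Hct. apply in_prod_iff in Hct. destruct Hct as [Hc Htau].
      apply in_seq in Htau.
      (* Dropping one occurrence of [c] shortens the list. The cells used after time [tau] differ
         from [c], so they remain in [Z1 ++ Z2] even if [c] is repeated there. *)
      destruct (in_split c Z Hc) as [Z1 [Z2 HZ]].
      destruct (IH (Z1 ++ Z2)) with (n := (n' - S tau)%nat) as [ws [Hlen Hws]].
      { rewrite HZ in HN. rewrite length_app in *. simpl in HN. lia. }
      { lia. }
      assert (Hk : forall i, exists k, (i <= tau)%nat -> forall x, V c x ->
         V c (Nat.iter tau f x) -> cmember U k (Nat.iter i f x)).
      { intros i. destruct (le_dec i tau) as [Hi|Hi].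
        - destruct (Hloop c tau i Hi) as [k Hk]. exists k. auto.
        - exists 0%nat. intros; lia. }
      destruct (functional_choice _ Hk) as [kk Hkk].
      (* Up to time [tau] the letters are the forced ones; afterwards come the words that the
         induction hypothesis provides for the orbit restarted at time [S tau]. *)
      exists (map (fun w i => if le_dec i tau then kk i else w (i - S tau)%nat) ws).
      split.
      - rewrite length_map. unfold m. etransitivity; [exact Hlen|].
        apply Nat.pow_le_mono_l. apply Nat.mul_le_mono_l. lia.
      - intros x [_ [Hx0 [Hx1 Hx2]]]; simpl in *.
        destruct (Hws (Nat.iter (S tau) f x)) as [w [Hw Hj]].
        + intros i Hi. rewrite <- Nat.iter_add.
          destruct (Hx2 (i + S tau)%nat) as [c' [Hc' [Hne HV]]]; [lia|].
          exists c'. split; [|exact HV]. rewrite HZ in Hc'.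
          rewrite in_app_iff in *. simpl in Hc'. intuition congruence.
        + exists (fun i => if le_dec i tau then kk i else w (i - S tau)%nat). split.
          * apply in_map_iff. eauto.
          * intros i Hi. destruct (le_dec i tau) as [Hle|Hle].
            -- apply Hkk; assumption.
            -- specialize (Hj (i - S tau)%nat). rewrite <- Nat.iter_add in Hj.
               replace (i - S tau + S tau)%nat with i in Hj by lia. apply Hj. lia. }
    destruct (coverable_union _ _ _ _ HQ) as [ws [Hlen Hws]].
    exists ws. split.
    + etransitivity; [exact Hlen|]. rewrite length_prod, length_seq, <- HN.
      rewrite Nat.pow_succ_r'. fold m. apply Nat.mul_le_mono_r. fold n'. nia.
    + intros x Hx. apply Hws.
      destruct (Hx 0%nat) as [c [Hc HVc]]; [unfold n'; lia|].
      destruct (last_time (fun i => V c (Nat.iter i f x)) n') as [tau [H1 [H2 H3]]];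
        [unfold n'; lia|exact HVc|].
      exists (c, tau). split; [apply in_prod_iff; split; [exact Hc|apply in_seq; lia]|].
      repeat split; simpl; auto.
      intros i Hi. destruct (Hx i) as [c' [Hc' HV']]; [unfold n' in *; lia|].
      exists c'. repeat split; auto. intros ->. apply (H3 i); [lia|exact HV'].
Qed.

End Counting.

(** * Polynomial growth has exponential rate at most zero *)

Lemma ln_le_compat x y : 0 < x -> x <= y -> ln x <= ln y.
Proof. intros Hx [H|H]; [left; apply ln_increasing; auto | subst; right; auto]. Qed.

Lemma ln_le_sqrt u : 0 < u -> ln u <= 2 * sqrt u.
Proof.
  intros Hu. assert (Hs := sqrt_lt_R0 u Hu).
  assert (E : ln u = ln (sqrt u) + ln (sqrt u)) by (rewrite <- ln_mult, sqrt_sqrt; auto; lra).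
  assert (ln (sqrt u) <= sqrt u).
  { apply Rle_trans with (ln (exp (sqrt u))); [|rewrite ln_exp; lra].
    apply ln_le_compat; [exact Hs|]. pose proof (exp_ineq1_le (sqrt u)). lra. }
  lra.
Qed.

Lemma polynomial_growth_rate (N : nat -> nat) (C K : nat) (l : R) :
  (forall n, (N n <= (C * S n) ^ K)%nat) ->
  Un_cv (fun n => ln (INR (N (S n))) / INR (S n)) l -> l <= 0.
Proof.
  intros HN Hcv. apply Rnot_lt_le. intros Hl.
  destruct (Hcv (l / 2)) as [n0 Hn0]; [lra|].
  assert (HCK : 0 <= INR C) by apply pos_INR. assert (HK : 0 <= INR K) by apply pos_INR.
  (* With [s] the square root of [u], the bounds below combine to [l * s * s < l * B * s], hence
     [u < B * B]; but [n] is taken so large that [B * B <= INR (S n) <= u]. *)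
  pose (B := 8 * (INR K + 1) * (INR C + 1) / l).
  assert (HB : 0 < B) by (unfold B; apply Rdiv_lt_0_compat; nra).
  destruct (INR_archimed 1 (B * B)) as [n1 Hn1]; [lra|].
  set (n := Nat.max n0 n1). specialize (Hn0 n). unfold Rdist in Hn0.
  assert (Hlow : l / 2 < ln (INR (N (S n))) / INR (S n)).
  { assert (H := Hn0 ltac:(unfold n; lia)). apply Rabs_def2 in H. lra. }
  assert (HSn : 0 < INR (S n)) by (apply lt_0_INR; lia).
  assert (Hlow' : l / 2 * INR (S n) < ln (INR (N (S n)))).
  { apply Rmult_lt_reg_r with (/ INR (S n)); [apply Rinv_0_lt_compat; exact HSn|].
    rewrite Rmult_assoc, Rinv_r, Rmult_1_r by lra. exact Hlow. }
  set (u := (INR C + 1) * INR (S (S n))).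
  assert (HSSn : INR (S (S n)) = INR (S n) + 1) by apply S_INR.
  assert (Hu : 0 < u) by (unfold u; nra).
  assert (Hup : ln (INR (N (S n))) <= INR K * ln u).
  { destruct (Nat.eq_dec (N (S n)) 0) as [E|E].
    - exfalso. assert (E0 : ln (INR (N (S n))) = 0).
      { rewrite E. unfold ln. simpl INR. destruct (Rlt_dec 0 0) as [H0|]; [destruct (Rlt_irrefl _ H0)|reflexivity]. }
      nra.
    - rewrite <- ln_pow by exact Hu. apply ln_le_compat; [apply lt_0_INR; lia|].
      apply Rle_trans with (INR ((C * S (S n)) ^ K)); [apply le_INR, HN|].
      rewrite pow_INR, mult_INR. apply pow_incr. unfold u. nra. }
  pose proof (ln_le_sqrt u Hu) as Hs.
  assert (Hn1' : B * B <= INR (S n)).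
  { apply Rle_trans with (INR n1); [lra|]. apply le_INR. unfold n. lia. }
  assert (Hsq := sqrt_lt_R0 u Hu). assert (Hss : sqrt u * sqrt u = u) by (apply sqrt_sqrt; lra).
  set (s := sqrt u) in *.
  assert (Hun : u <= 2 * (INR C + 1) * INR (S n)).
  { unfold u. assert (1 <= INR (S n)) by (change 1 with (INR 1); apply le_INR; lia). nra. }
  assert (H1 : l / 2 * INR (S n) < 2 * (INR K + 1) * s) by nra.
  assert (HlB : l * B = 8 * (INR K + 1) * (INR C + 1)) by (unfold B; field; lra).
  assert (H2 : l * (s * s) < l * B * s).
  { rewrite Hss, HlB. apply Rle_lt_trans with (l * (2 * (INR C + 1) * INR (S n))).
    - apply Rmult_le_compat_l; lra.
    - nra. }
  assert (H3 : s < B).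
  { apply Rmult_lt_reg_l with (l * s); [nra|]. nra. }
  assert (H4 : u < B * B) by nra.
  assert (u >= INR (S n)) by (unfold u; nra). lra.
Qed.

(** * Chains, linked pairs and their behaviour under limits *)

Definition pick {X : Type} (a b : X) (c : bool) : X := if c then b else a.

Section Chains.

Context {X : Type} (d : X -> X -> R) (f : X -> X).

Definition pseudo_orbit (eps : R) (n : nat) (u : nat -> X) : Prop :=
  forall i, (i < n)%nat -> d (f (u i)) (u (S i)) < eps.

Definition chain (eps : R) (n : nat) (p q : X) : Prop :=
  exists u, u 0%nat = p /\ u n = q /\ pseudo_orbit eps n u.

(** The common length [n] lets the four chains be concatenated along any word in two symbols, with
    the letters read off at multiples of [n]. *)
Definition linked (eps : R) (a b : X) : Prop :=
  exists n, (1 <= n)%nat /\ forall c c', chain eps n (pick a b c) (pick a b c').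

Definition splice (n : nat) (u v : nat -> X) : nat -> X :=
  fun i => if lt_dec i n then u i else v (i - n)%nat.

Lemma splice_l n u v i : (i < n)%nat -> splice n u v i = u i.
Proof. intros H. unfold splice. destruct (lt_dec i n); [reflexivity|lia]. Qed.

Lemma splice_r n u v i : splice n u v (n + i) = v i.
Proof.
  unfold splice. destruct (lt_dec (n + i) n); [lia|]. f_equal; lia.
Qed.

Lemma splice_l' n u v i : u n = v 0%nat -> (i <= n)%nat -> splice n u v i = u i.
Proof.
  intros E H. destruct (Nat.eq_dec i n) as [->|Hne]; [|apply splice_l; lia].
  rewrite E, <- (splice_r n u v 0), Nat.add_0_r. reflexivity.
Qed.

Lemma pseudo_orbit_splice eps n m u v :
  pseudo_orbit eps n u -> u n = v 0%nat -> pseudo_orbit eps m v ->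
  pseudo_orbit eps (n + m) (splice n u v).
Proof.
  intros Hu E Hv i Hi. destruct (lt_dec i n) as [H|H].
  - rewrite !splice_l' by (auto; lia). apply Hu; exact H.
  - replace i with (n + (i - n))%nat by lia.
    rewrite <- Nat.add_succ_r, !splice_r. apply Hv. lia.
Qed.

Lemma chain_trans eps n m p q r :
  chain eps n p q -> chain eps m q r -> chain eps (n + m) p r.
Proof.
  intros [u [Hu0 [Hun Hu]]] [v [Hv0 [Hvm Hv]]].
  assert (E : u n = v 0%nat) by congruence.
  exists (splice n u v). split; [rewrite splice_l' by (auto; lia); exact Hu0|].
  split; [rewrite splice_r; exact Hvm|]. apply pseudo_orbit_splice; auto.
Qed.

Lemma pseudo_orbit_mono eps eps' n u : eps <= eps' -> pseudo_orbit eps n u -> pseudo_orbit eps' n u.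
Proof. intros H Hu i Hi. specialize (Hu i Hi). lra. Qed.

Lemma chain_mono eps eps' n p q : eps <= eps' -> chain eps n p q -> chain eps' n p q.
Proof.
  intros H [u [H0 [H1 Hu]]]. exists u. repeat split; auto.
  apply pseudo_orbit_mono with eps; auto.
Qed.

Lemma linked_mono eps eps' a b : eps <= eps' -> linked eps a b -> linked eps' a b.
Proof.
  intros H [n [Hn Hc]]. exists n. split; [exact Hn|]. intros c c'.
  apply chain_mono with eps; auto.
Qed.

Context (Hd : is_metric d).

Lemma pseudo_orbit_orbit eps n p : 0 < eps -> pseudo_orbit eps n (fun i => Nat.iter i f p).
Proof. intros He i Hi. simpl. rewrite (metric_refl Hd). exact He. Qed.

Lemma chain_orbit eps n p : 0 < eps -> chain eps n p (Nat.iter n f p).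
Proof.
  intros He. exists (fun i => Nat.iter i f p). repeat split; auto.
  apply pseudo_orbit_orbit; exact He.
Qed.

(** Only the first and the last link change. If [n = 1] these are the same link, which then bears
    two replacements besides its own error; hence the factor 3. *)
Lemma chain_perturb eps n p q p' q' : (1 <= n)%nat -> chain eps n p q ->
  d (f p') (f p) < eps -> d q q' < eps -> chain (3 * eps) n p' q'.
Proof.
  intros Hn [u [Hu0 [Hun Hu]]] Hp Hq.
  pose (w := fun i => if Nat.eq_dec i 0 then p' else if Nat.eq_dec i n then q' else u i).
  exists w. unfold w. split; [reflexivity|]. split.
  { destruct (Nat.eq_dec n 0); [lia|]. destruct (Nat.eq_dec n n); [reflexivity|lia]. }
  intros i Hi. specialize (Hu i Hi).
  assert (H1 : d (f (w i)) (f (u i)) < eps).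
  { unfold w. destruct (Nat.eq_dec i 0) as [->|H0]; [rewrite Hu0; exact Hp|].
    destruct (Nat.eq_dec i n); [lia|]. rewrite (metric_refl Hd).
    pose proof (metric_nonneg Hd q q'). lra. }
  assert (H2 : d (u (S i)) (w (S i)) < eps).
  { unfold w. destruct (Nat.eq_dec (S i) 0); [lia|].
    destruct (Nat.eq_dec (S i) n) as [E|E]; [rewrite E, Hun; exact Hq|].
    rewrite (metric_refl Hd). pose proof (metric_nonneg Hd q q'). lra. }
  change (d (f (w i)) (w (S i)) < 3 * eps).
  pose proof (metric_tri Hd (f (w i)) (f (u i)) (w (S i))).
  pose proof (metric_tri Hd (f (u i)) (u (S i)) (w (S i))). lra.
Qed.

(** Being linked at every scale is a closed condition: chains of a nearby pair keep their common
    length when their endpoints are moved. *)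
Lemma linked_limit (Hf : continuous_map d f) x y :
  (forall eps, 0 < eps -> exists p q, d x p < eps /\ d y q < eps /\ linked eps p q) ->
  forall eps, 0 < eps -> linked eps x y.
Proof.
  intros H eps He.
  destruct (Hf x (eps / 3)) as [d1 [Hd1 H1]]; [lra|].
  destruct (Hf y (eps / 3)) as [d2 [Hd2 H2]]; [lra|].
  set (r := Rmin (eps / 3) (Rmin d1 d2)).
  assert (Hr : 0 < r) by (unfold r; repeat apply Rmin_glb_lt; lra).
  assert (Hr0 : r <= eps / 3) by apply Rmin_l.
  assert (Hr1 : r <= d1) by (eapply Rle_trans; [apply Rmin_r|apply Rmin_l]).
  assert (Hr2 : r <= d2) by (eapply Rle_trans; [apply Rmin_r|apply Rmin_r]).
  destruct (H r Hr) as [p [q [Hp [Hq [n [Hn Hc]]]]]].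
  exists n. split; [exact Hn|]. intros c c'.
  replace eps with (3 * (eps / 3)) by field.
  apply chain_perturb with (pick p q c) (pick p q c'); [exact Hn| | |].
  - apply chain_mono with r; auto.
  - destruct c; simpl; [apply H2|apply H1]; lra.
  - rewrite (metric_sym Hd). destruct c'; simpl; lra.
Qed.

(* The loop of [x1] up to time [l] is closed up through [x2]. *)
Lemma chain_through eps r l i x1 x2 : 0 < eps -> r <= eps / 3 ->
  (forall p q, d p q < r -> d (f p) (f q) < eps / 3) ->
  (1 <= l)%nat -> (i <= l)%nat -> d (Nat.iter l f x1) x2 < r ->
  chain eps l (Nat.iter i f x1) (Nat.iter i f x2).
Proof.
  intros He Hr Hu Hl Hi Hx. replace eps with (3 * (eps / 3)) by field.
  (* The chain follows the orbit of [x1] from time [i] to time [l], jumps to [x2] and follows its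
     orbit for [i] steps. For [i = l] the first piece is empty, and the jump is absorbed by uniform
     continuity into the first link of the orbit of [x2]. *)
  destruct (Nat.eq_dec i l) as [->|Hne].
  - apply chain_perturb with x2 (Nat.iter l f x2); [exact Hl| | |].
    + apply chain_orbit; lra.
    + apply Hu; exact Hx.
    + rewrite (metric_refl Hd). lra.
  - replace l with (l - i + i)%nat at 1 by lia.
    apply chain_trans with x2; [|apply chain_orbit; lra].
    apply chain_perturb with (Nat.iter i f x1) (Nat.iter l f x1); [lia| | |].
    + replace (Nat.iter l f x1) with (Nat.iter (l - i) f (Nat.iter i f x1))
        by (rewrite <- Nat.iter_add; f_equal; lia).
      apply chain_orbit; lra.
    + rewrite (metric_refl Hd). lra.
    + lra.
Qed.

(** * From positive entropy to linked pairs *)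

Context (Hcpt : compact_space d) (Hf : continuous_map d f).

(** No member of [U] contains the whole family. If no such family existed, the letter at time [i]
    could be chosen the same for all loops of equal length at a small cell, so polynomially many
    words would suffice. The alternative [d (p k) (p k') < eps] accounts for loops of length 0. *)
Lemma positive_entropy_linked_family (U : list (X -> Prop)) : cover_entropy_pos f U ->
  forall eps, 0 < eps -> exists p : nat -> X,
    (forall k, ~ cmember U k (p k)) /\
    forall k k', d (p k) (p k') < eps \/ linked eps (p k) (p k').
Proof.
  intros [l [Hl [N [HN Hcv]]]] eps He. apply NNPP. intros Hno.
  destruct (uniformly_continuous Hd Hcpt f Hf (eps / 3)) as [r0 [Hr0 Huc]]; [lra|].
  set (r := Rmin r0 (eps / 3)).
  assert (Hr : 0 < r) by (apply Rmin_glb_lt; lra).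
  assert (Hr1 : r <= r0) by apply Rmin_l. assert (Hr2 : r <= eps / 3) by apply Rmin_r.
  destruct (finite_net Hd Hcpt (r / 2)) as [Z HZ]; [lra|].
  assert (Hloop : forall c l i, (i <= l)%nat -> exists k, forall x,
     d c x < r / 2 -> d c (Nat.iter l f x) < r / 2 -> cmember U k (Nat.iter i f x)).
  { intros c m i Hi. apply NNPP. intros Hk. apply Hno.
    assert (H : forall k, exists x, d c x < r / 2 /\ d c (Nat.iter m f x) < r / 2 /\
      ~ cmember U k (Nat.iter i f x)).
    { intros k. apply NNPP. intros Hx. apply Hk. exists k. intros x H1 H2.
      apply NNPP. intros H3. apply Hx. eauto. }
    destruct (functional_choice _ H) as [x Hx].
    (* For each index [k] there is a loop of length [m] at [c] whose point at time [i] misses member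
       [k]; these points form the excluded family. *)
    exists (fun k => Nat.iter i f (x k)). split; [intros k; apply Hx|].
    assert (Hclose : forall p q, d c p < r / 2 -> d c q < r / 2 -> d p q < r).
    { intros p q Hp Hq. pose proof (metric_tri Hd p c q).
      rewrite (metric_sym Hd p c) in H0. lra. }
    intros k k'. destruct (Hx k) as [A1 [A2 _]]. destruct (Hx k') as [B1 [B2 _]].
    destruct (Nat.eq_dec m 0) as [->|Hm].
    - left. assert (i = 0)%nat as -> by lia. simpl.
      specialize (Hclose _ _ A1 B1). lra.
    - right. exists m. split; [lia|]. intros e e'.
      assert (Ep : forall e, pick (Nat.iter i f (x k)) (Nat.iter i f (x k')) e =
        Nat.iter i f (pick (x k) (x k') e)) by (intros []; reflexivity).
      rewrite !Ep. apply chain_through with r; auto; [|lia|].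
      + intros p q Hpq. apply Huc. lra.
      + apply Hclose; [destruct e|destruct e']; assumption. }
  set (C := S (length Z)).
  apply (Rlt_not_le _ _ Hl).
  apply polynomial_growth_rate with N C (length Z); [|exact Hcv].
  intros n.
  destruct (polynomially_many_words f U (fun c x => d c x < r / 2) C Hloop Z n) as [ws [Hlen Hws]];
    [unfold C; lia|].
  etransitivity; [|exact Hlen]. apply (proj2 (HN n)).
  intros x. apply Hws. intros i _. apply HZ.
Qed.

(** The complements of small closed balls around [x] and [y] form a cover of positive entropy.
    Points that miss one member each lie in the two balls, which are too far apart for the closeness
    alternative, so they are linked; then the balls shrink. *)
Lemma entropy_pair_linked x y : entropy_pair d f x y -> forall eps, 0 < eps -> linked eps x y.
Proof.
  intros [Hne Hxy]. apply (linked_limit Hf). intros eps He.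
  pose proof (metric_pos Hd x y Hne) as Hpos.
  set (r := Rmin (eps / 2) (d x y / 3)).
  assert (Hr : 0 < r) by (apply Rmin_glb_lt; lra).
  assert (Hr1 : r <= eps / 2) by apply Rmin_l. assert (Hr2 : r <= d x y / 3) by apply Rmin_r.
  assert (Hsep : forall p q, d x p <= r -> d y q <= r -> r <= d p q).
  { intros p q Hp Hq. pose proof (metric_tri Hd x p y). pose proof (metric_tri Hd p q y).
    rewrite (metric_sym Hd q y) in H0. lra. }
  assert (Hent : cover_entropy_pos f ((fun z => ~ d x z <= r) :: (fun z => ~ d y z <= r) :: nil)).
  { apply Hxy.
    - apply is_closed_closed_ball; exact Hd.
    - exists r. split; [exact Hr|]. intros z Hz. lra.
    - apply is_closed_closed_ball; exact Hd.
    - exists r. split; [exact Hr|]. intros z Hz. lra.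
    - intros z [H1 H2]. specialize (Hsep z z H1 H2). rewrite (metric_refl Hd) in Hsep. lra. }
  destruct (positive_entropy_linked_family _ Hent r Hr) as [p [Hp Hl]].
  assert (H0 := NNPP _ (Hp 0%nat)). assert (H1 := NNPP _ (Hp 1%nat)). simpl in H0, H1.
  exists (p 0%nat), (p 1%nat). split; [lra|]. split; [lra|].
  specialize (Hsep _ _ H0 H1). destruct (Hl 0%nat 1%nat) as [H|H]; [lra|].
  apply linked_mono with r; [lra|exact H].
Qed.

(** A Lebesgue number [lam] of the cover keeps the linked pairs of all scales at distance at least
    [lam], so a cluster point of these pairs has distinct coordinates. *)
Lemma positive_entropy_linked_pair : htop_pos d f ->
  exists x y, x <> y /\ forall eps, 0 < eps -> linked eps x y.
Proof.
  intros [U [HU Hent]].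
  destruct (lebesgue_number Hd Hcpt U HU) as [lam [Hlam Hleb]].
  assert (H : forall n, exists pq : X * X, lam <= d (fst pq) (snd pq) /\
    linked (/ INR (S n)) (fst pq) (snd pq)).
  { intros n. pose proof (inv_INR_S_pos n) as Hn.
    destruct (positive_entropy_linked_family U Hent (Rmin lam (/ INR (S n)))) as [p [Hp Hl]];
      [apply Rmin_glb_lt; assumption|].
    destruct (Hleb (p 0%nat)) as [k Hk].
    assert (Hge : lam <= d (p 0%nat) (p k)).
    { apply Rnot_lt_le. intros Hlt. exact (Hp k (Hk _ Hlt)). }
    exists (p 0%nat, p k). split; [exact Hge|]. simpl fst; simpl snd.
    pose proof (Rmin_l lam (/ INR (S n))).
    destruct (Hl 0%nat k) as [Hlt|Hlk]; [lra|].
    apply linked_mono with (Rmin lam (/ INR (S n))); [apply Rmin_r|exact Hlk]. }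
  destruct (functional_choice _ H) as [pq Hpq].
  destruct (cluster_pair_exists Hd Hcpt (fun n => fst (pq n)) (fun n => snd (pq n))) as [x [y Hxy]].
  exists x, y. split.
  - intros <-. destruct (Hxy (lam / 2) 0%nat) as [n [_ [H1 H2]]]; [lra|].
    destruct (Hpq n) as [H3 _].
    pose proof (metric_tri Hd (fst (pq n)) x (snd (pq n))).
    rewrite (metric_sym Hd (fst (pq n)) x) in H0. lra.
  - apply (linked_limit Hf). intros eps He. destruct (inv_INR_S_lt eps He) as [K HK].
    destruct (Hxy eps K He) as [n [Hn [H1 H2]]].
    exists (fst (pq n)), (snd (pq n)). repeat split; auto.
    apply linked_mono with (/ INR (S n)); [left; apply HK; exact Hn|apply Hpq].
Qed.

End Chains.

(** * Limit shadowing: itineraries and distal linked pairs *)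

Section Shadowing.

Context {X : Type} (d : X -> X -> R) (f : X -> X).
Context (Hd : is_metric d) (Hls : limit_shadowing d f).

(** Block [k] starts at time [T k]. All blocks begin and end at [a], so they fit together, and the
    errors [/ INR (S k)] tend to 0: the concatenation is a limit pseudo orbit. *)
Lemma shadow_concatenation (T : nat -> nat) (W : nat -> nat -> X) (a : X) :
  T 0%nat = 0%nat -> (forall k, (T k < T (S k))%nat) ->
  (forall k, W k 0%nat = a) -> (forall k, W k (T (S k) - T k)%nat = a) ->
  (forall k, pseudo_orbit d f (/ INR (S k)) (T (S k) - T k) (W k)) ->
  exists z, forall eps, 0 < eps -> exists M, forall k i, (M <= k)%nat ->
    (i <= T (S k) - T k)%nat -> d (Nat.iter (T k + i) f z) (W k i) < eps.
Proof.
  intros HT0 HTS HW0 HW1 HW.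
  assert (Hmono : forall j i, (i <= j)%nat -> (T i <= T j)%nat).
  { induction j as [|j IH]; intros i Hi.
    - replace i with 0%nat by lia. lia.
    - destruct (Nat.eq_dec i (S j)) as [->|Hne]; [lia|].
      specialize (IH i). specialize (HTS j). lia. }
  assert (Hge : forall k, (k <= T k)%nat).
  { induction k as [|k IH]; [lia|]. specialize (HTS k). lia. }
  assert (Hst : forall m, exists k, (T k <= m < T (S k))%nat).
  { induction m as [|m [k Hk]].
    - exists 0%nat. specialize (HTS 0%nat). lia.
    - destruct (lt_dec (S m) (T (S k))) as [H|H]; [exists k; lia|].
      exists (S k). specialize (HTS (S k)). lia. }
  destruct (functional_choice _ Hst) as [K HK].
  assert (HKk : forall k i, (i < T (S k) - T k)%nat -> K (T k + i)%nat = k).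
  { intros k i Hi. specialize (HK (T k + i)%nat).
    destruct (lt_eq_lt_dec (K (T k + i)%nat) k) as [[H|H]|H]; [|exact H|].
    - specialize (Hmono k (S (K (T k + i)%nat))). lia.
    - specialize (Hmono (K (T k + i)%nat) (S k)). lia. }
  pose (xi := fun m => W (K m) (m - T (K m))%nat).
  assert (Hxi : forall k i, (i <= T (S k) - T k)%nat -> xi (T k + i)%nat = W k i).
  { intros k i Hi. unfold xi. destruct (Nat.eq_dec i (T (S k) - T k)) as [->|Hne].
    - replace (T k + (T (S k) - T k))%nat with (T (S k) + 0)%nat
        by (specialize (HTS k); lia).
      rewrite HKk by (specialize (HTS (S k)); lia).
      rewrite HW1, Nat.add_0_r, Nat.sub_diag. apply HW0.
    - rewrite HKk by lia. f_equal. lia. }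
  destruct (Hls xi) as [z Hz].
  { intros eps He. destruct (inv_INR_S_lt eps He) as [M HM].
    exists (T M). intros m Hm. unfold Rdist.
    rewrite Rminus_0_r, Rabs_pos_eq by apply (metric_nonneg Hd).
    destruct (Hst m) as [k Hk].
    assert (HMk : (M <= k)%nat).
    { destruct (le_dec M k) as [H|H]; [exact H|]. specialize (Hmono M (S k)). lia. }
    replace m with (T k + (m - T k))%nat by lia.
    rewrite <- Nat.add_succ_r, !Hxi by lia.
    apply Rlt_trans with (/ INR (S k)); [|apply HM; exact HMk].
    apply HW. lia. }
  exists z. intros eps He. destruct (Hz eps He) as [M HM]. exists M.
  intros k i Hk Hi. specialize (HM (T k + i)%nat). unfold Rdist in HM.
  rewrite Rminus_0_r, Rabs_pos_eq, Hxi in HM by (auto; apply (metric_nonneg Hd)).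
  apply HM. specialize (Hge k). lia.
Qed.

Lemma linked_word eps n x y :
  (forall c c', chain d f eps n (pick x y c) (pick x y c')) ->
  forall (v : nat -> bool) M, exists u, pseudo_orbit d f eps (M * n) u /\
    forall j, (j <= M)%nat -> u (j * n)%nat = pick x y (v j).
Proof.
  intros Hc v M. induction M as [|M [u [Hu Hv]]].
  - exists (fun _ => pick x y (v 0%nat)). split.
    + intros i Hi. simpl in Hi. lia.
    + intros j Hj. replace j with 0%nat by lia. reflexivity.
  - destruct (Hc (v M) (v (S M))) as [w [Hw0 [Hw1 Hw]]].
    assert (E : u (M * n)%nat = w 0%nat) by (rewrite Hw0; apply Hv; lia).
    exists (splice (M * n) u w). split.
    + replace (S M * n)%nat with (M * n + n)%nat by lia.
      apply pseudo_orbit_splice; auto.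
    + intros j Hj. destruct (Nat.eq_dec j (S M)) as [->|Hne].
      * replace (S M * n)%nat with (M * n + n)%nat by lia.
        rewrite splice_r. exact Hw1.
      * rewrite splice_l' by (auto; apply Nat.mul_le_mono_r; lia). apply Hv. lia.
Qed.

Context (Hcpt : compact_space d) (Hf : continuous_map d f).

Lemma iter_cluster_point_le (u : nat -> X) b p m N r : cluster_point (d := d) u b ->
  (forall k, (N <= k)%nat -> d (Nat.iter m f (u k)) p <= r) -> d (Nat.iter m f b) p <= r.
Proof.
  intros Hb Hu. apply Rnot_lt_le. intros Hlt.
  destruct (continuous_iter f m Hf b (d (Nat.iter m f b) p - r)) as [del [Hdel Hc]]; [lra|].
  destruct (Hb del N Hdel) as [k [Hk Hbk]]. specialize (Hc _ Hbk). specialize (Hu k Hk).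
  pose proof (metric_tri Hd (Nat.iter m f b) (Nat.iter m f (u k)) p). lra.
Qed.

(* If no word length worked, then for each k a finite stretch of the itinerary would fail to be
   shadowed along the links of size 1/k; concatenating these stretches gives a limit pseudo
   orbit, whose limit shadowing point does follow the late stretches. *)
Lemma linked_itinerary x y : (forall eps, 0 < eps -> linked d f eps x y) ->
  forall (t : nat -> bool) r, 0 < r -> exists n z, (1 <= n)%nat /\
    forall j, d (Nat.iter (j * n) f z) (pick x y (t j)) <= r.
Proof.
  intros Hxy t r Hr. apply NNPP. intros Hno.
  (* By compactness failure occurs within a bounded number [J] of letters: points that follow the
     itinerary up to each [J] would cluster at one that follows all of it. *)
  assert (HJ : forall n, (1 <= n)%nat -> exists J, forall z, exists j, (j <= J)%nat /\
    r < d (Nat.iter (j * n) f z) (pick x y (t j))).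
  { intros n Hn. apply NNPP. intros HJ. apply Hno.
    assert (H : forall J, exists z, forall j, (j <= J)%nat ->
      d (Nat.iter (j * n) f z) (pick x y (t j)) <= r).
    { intros J. apply NNPP. intros Hz. apply HJ. exists J. intros z. apply NNPP. intros Hj.
      apply Hz. exists z. intros j Hle. apply Rnot_lt_le. intros Hlt. apply Hj. eauto. }
    destruct (functional_choice _ H) as [zz Hzz].
    destruct (cluster_point_exists Hd Hcpt zz) as [z Hz].
    exists n, z. split; [exact Hn|]. intros j.
    apply iter_cluster_point_le with zz j; [exact Hz|]. intros k Hk. apply Hzz. exact Hk. }
  assert (Hst : forall k, exists p : nat * nat * (nat -> X),
    let n := fst (fst p) in let J := snd (fst p) in let u := snd p in
    (1 <= n)%nat /\ pseudo_orbit d f (/ INR (S k)) ((J + 2) * n) u /\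
    u 0%nat = x /\ u ((J + 2) * n)%nat = x /\
    (forall j, (j <= J)%nat -> u (n + j * n)%nat = pick x y (t j)) /\
    forall z, exists j, (j <= J)%nat /\ r < d (Nat.iter (j * n) f z) (pick x y (t j))).
  { intros k. destruct (Hxy _ (inv_INR_S_pos k)) as [n [Hn Hc]].
    destruct (HJ n Hn) as [J HJn].
    (* The word is [x], then the letters [t 0] to [t J], then [x]. Thus every stretch begins and
       ends at [x], and the itinerary starts one link after the beginning. *)
    destruct (linked_word _ _ _ _ Hc
      (fun j => match j with O => false | S i => if le_dec i J then t i else false end) (J + 2))
      as [u [Hu Hv]].
    exists (n, J, u). simpl fst; simpl snd. cbv zeta.
    split; [exact Hn|]. split; [exact Hu|]. split; [apply (Hv 0%nat); lia|]. split.
    { rewrite Hv by lia. replace (J + 2)%nat with (S (S J)) by lia.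
      destruct (le_dec (S J) J); [lia|reflexivity]. }
    split; [|exact HJn].
    intros j Hj. change (n + j * n)%nat with (S j * n)%nat. rewrite Hv by lia.
    destruct (le_dec j J); [reflexivity|lia]. }
  destruct (functional_choice _ Hst) as [p Hp]. cbv zeta in Hp.
  set (L := fun k => ((snd (fst (p k)) + 2) * fst (fst (p k)))%nat).
  pose (T := nat_rect (fun _ => nat) 0%nat (fun k s => (s + L k)%nat)).
  assert (HTS : forall k, T (S k) = (T k + L k)%nat) by reflexivity.
  assert (HL : forall k, (T (S k) - T k)%nat = L k) by (intros k; rewrite HTS; lia).
  destruct (shadow_concatenation T (fun k => snd (p k)) x) as [z Hz].
  - reflexivity.
  - intros k. rewrite HTS. unfold L. destruct (Hp k) as [Hn _]. nia.
  - intros k. apply Hp.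
  - intros k. rewrite HL. apply Hp.
  - intros k. rewrite HL. apply Hp.
  - destruct (Hz r Hr) as [M HM]. destruct (Hp M) as [Hn [_ [_ [_ [Ht Hbad]]]]].
    destruct (Hbad (Nat.iter (T M + fst (fst (p M))) f z)) as [j [Hj Hlt]].
    specialize (HM M (fst (fst (p M)) + j * fst (fst (p M)))%nat (le_n M)).
    rewrite HL, Ht in HM by exact Hj. rewrite <- Nat.iter_add in Hlt.
    replace (j * fst (fst (p M)) + (T M + fst (fst (p M))))%nat
      with (T M + (fst (fst (p M)) + j * fst (fst (p M))))%nat in Hlt by lia.
    apply (Rlt_asym _ _ Hlt). apply HM. unfold L. nia.
Qed.

(** The orbit of [z] under the n-th iterate comes near [p] and later near [q]; the segment in
    between becomes a chain once its ends are moved to [p] and [q]. *)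
Lemma chain_between_cluster_points n z p q : (1 <= n)%nat ->
  cluster_point (d := d) (fun j => Nat.iter (j * n) f z) p ->
  cluster_point (d := d) (fun j => Nat.iter (j * n) f z) q ->
  forall eps, 0 < eps -> exists m, (1 <= m)%nat /\ chain d f eps (m * n) p q.
Proof.
  intros Hn Hp Hq eps He.
  destruct (Hf p (eps / 3)) as [del [Hdel Hc]]; [lra|].
  destruct (Hp del 0%nat Hdel) as [j [_ Hj]].
  destruct (Hq (eps / 3) (S j)) as [j' [Hj' Hqj]]; [lra|].
  exists (j' - j)%nat. split; [lia|]. replace eps with (3 * (eps / 3)) by field.
  apply (chain_perturb d f Hd) with (Nat.iter (j * n) f z) (Nat.iter (j' * n) f z).
  - nia.
  - replace (j' * n)%nat with ((j' - j) * n + j * n)%nat by nia. rewrite Nat.iter_add.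
    apply chain_orbit; [exact Hd|lra].
  - apply Hc. exact Hj.
  - rewrite (metric_sym Hd). exact Hqj.
Qed.

Lemma cluster_point_iter n z p s :
  cluster_point (d := d) (fun j => Nat.iter (j * n) f z) p ->
  cluster_point (d := d) (fun j => Nat.iter (j * n) f z) (Nat.iter (s * n) f p).
Proof.
  intros Hp eps N He. destruct (continuous_iter f (s * n) Hf p eps He) as [del [Hdel Hc]].
  destruct (Hp del N Hdel) as [j [Hj Hpj]]. exists (s + j)%nat. split; [lia|].
  rewrite Nat.mul_add_distr_r, Nat.iter_add. apply Hc. exact Hpj.
Qed.

(* With chains a -> b of length P and b -> a of length Q, the point f^Q(b) is reached from a in
   P + Q steps, which is also the length of a loop at a. *)
Lemma linked_with_iterate n z a b : (1 <= n)%nat ->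
  cluster_point (d := d) (fun j => Nat.iter (j * n) f z) a ->
  cluster_point (d := d) (fun j => Nat.iter (j * n) f z) b ->
  forall eps, 0 < eps -> exists s, linked d f eps a (Nat.iter (s * n) f b).
Proof.
  intros Hn Ha Hb eps He.
  destruct (chain_between_cluster_points n z a b Hn Ha Hb eps He) as [P [HP1 HP]].
  destruct (chain_between_cluster_points n z b a Hn Hb Ha eps He) as [s [_ Hs]].
  pose proof (cluster_point_iter n z b s Hb) as Hb'.
  exists s. set (b' := Nat.iter (s * n) f b) in *.
  destruct (chain_between_cluster_points n z b' a Hn Hb' Ha eps He) as [v0 [_ Hv0]].
  set (u := (P * n + s * n)%nat).
  assert (Haa : chain d f eps u a a) by (apply chain_trans with b; assumption).
  assert (Hab : chain d f eps u a b').
  { apply chain_trans with b; [assumption|]. apply chain_orbit; assumption. }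
  assert (Hba : chain d f eps (v0 * n + u) b' a) by (apply chain_trans with a; assumption).
  assert (Haa' : chain d f eps (v0 * n + u) a a).
  { rewrite Nat.add_comm. apply chain_trans with b'; assumption. }
  (* Every chain passes through [a]: either point reaches [a] in [v0 * n + u] steps, and [a] reaches
     either point in [u] steps. *)
  exists (v0 * n + u + u)%nat. split; [unfold u; nia|].
  intros [] []; simpl; eapply chain_trans; eassumption.
Qed.

Lemma iterates_uniformly_continuous n : forall eps, 0 < eps -> exists delta, 0 < delta /\
  forall r, (r <= n)%nat -> forall p q, d p q < delta -> d (Nat.iter r f p) (Nat.iter r f q) < eps.
Proof.
  intros eps He. induction n as [|n [d1 [Hd1 H1]]].
  - exists eps. split; [exact He|]. intros r Hr p q Hpq. replace r with 0%nat by lia. exact Hpq.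
  - destruct (uniformly_continuous Hd Hcpt _ (continuous_iter f (S n) Hf) eps He) as [d2 [Hd2 H2]].
    exists (Rmin d1 d2). split; [apply Rmin_glb_lt; assumption|].
    intros r Hr p q Hpq. pose proof (Rmin_l d1 d2). pose proof (Rmin_r d1 d2).
    destruct (Nat.eq_dec r (S n)) as [->|Hne]; [apply H2; lra|apply H1; [lia|lra]].
Qed.

Lemma linked_distal_pair x y : x <> y -> (forall eps, 0 < eps -> linked d f eps x y) ->
  forall rho, 0 < rho -> exists a b delta, d a x <= rho /\ d b y <= rho /\
    (forall eps, 0 < eps -> linked d f eps a b) /\
    0 < delta /\ forall i, delta <= d (Nat.iter i f a) (Nat.iter i f b).
Proof.
  intros Hne Hxy rho Hrho. pose proof (metric_pos Hd x y Hne) as Hpos.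
  set (r := Rmin rho (d x y / 3)).
  assert (Hr : 0 < r) by (apply Rmin_glb_lt; lra).
  assert (Hr1 : r <= rho) by apply Rmin_l. assert (Hr2 : r <= d x y / 3) by apply Rmin_r.
  (* An itinerary with arbitrarily long runs of both symbols. *)
  set (t := fun j => Nat.odd (Nat.sqrt j)).
  assert (Ht : forall k i, (i <= k)%nat -> t (i + k * k)%nat = Nat.odd k).
  { intros k i Hi. unfold t. rewrite (Nat.sqrt_unique (i + k * k) k); [reflexivity|nia]. }
  destruct (linked_itinerary x y Hxy t r Hr) as [n [z [Hn Hz]]].
  assert (Hrun : forall c : bool, exists p,
    cluster_point (d := d) (fun j => Nat.iter (j * n) f z) p /\
    forall j, d (Nat.iter (j * n) f p) (pick x y c) <= r).
  (* The [m k] run through the numbers of parity [c]. The run of symbol [c] that starts at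
     [m k * m k] gets longer with [k], so a cluster point of the run starts follows [c] forever. *)
  { intros c. set (m := fun k => (2 * k + Nat.b2n c)%nat).
    assert (Hm : forall k, Nat.odd (m k) = c).
    { intros k. unfold m. rewrite Nat.add_comm, Nat.odd_add_mul_2. destruct c; reflexivity. }
    destruct (cluster_point_exists Hd Hcpt (fun k => Nat.iter (m k * m k * n) f z)) as [p Hp].
    exists p. split.
    - intros eps N He. destruct (Hp eps N He) as [k [Hk Hpk]].
      exists (m k * m k)%nat. split; [unfold m; nia|exact Hpk].
    - intros j. apply iter_cluster_point_le with (fun k => Nat.iter (m k * m k * n) f z) j;
        [exact Hp|].
      intros k Hk. rewrite <- Nat.iter_add, <- Nat.mul_add_distr_r.
      rewrite <- (Hm k), <- (Ht (m k) j); [apply Hz|unfold m; lia]. }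
  destruct (Hrun false) as [a [Hac Ha]]. destruct (Hrun true) as [b0 [Hbc Hb0]]. simpl in Ha, Hb0.
  (* How far [b0] must be moved along its orbit depends on the scale. A cluster point [b] of the
     moved points serves all scales and still stays near [y] at multiples of [n]. *)
  assert (Hs : forall k, exists s, linked d f (/ INR (S k)) a (Nat.iter (s * n) f b0)).
  { intros k. apply linked_with_iterate with z; auto. apply inv_INR_S_pos. }
  destruct (functional_choice _ Hs) as [s Hsk].
  destruct (cluster_point_exists Hd Hcpt (fun k => Nat.iter (s k * n) f b0)) as [b Hb].
  assert (Hby : forall j, d (Nat.iter (j * n) f b) y <= r).
  { intros j. apply iter_cluster_point_le with (fun k => Nat.iter (s k * n) f b0) 0%nat; [exact Hb|].
    intros k _. rewrite <- Nat.iter_add, <- Nat.mul_add_distr_r. apply Hb0. }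
  destruct (iterates_uniformly_continuous n (d x y / 3)) as [del [Hdel Huc]]; [lra|].
  exists a, b, del. split; [specialize (Ha 0%nat); simpl in Ha; lra|].
  split; [specialize (Hby 0%nat); simpl in Hby; lra|]. split; [|split; [exact Hdel|]].
  - apply (linked_limit d f Hd Hf). intros eps He. destruct (inv_INR_S_lt eps He) as [K HK].
    destruct (Hb eps K He) as [k [Hk Hbk]]. exists a, (Nat.iter (s k * n) f b0).
    rewrite (metric_refl Hd). repeat split; auto.
    apply linked_mono with (/ INR (S k)); [left; apply HK; exact Hk|apply Hsk].
  - intros i. apply Rnot_lt_le. intros Hlt.
    (* [j * n] is the first multiple of [n] beyond [i], at most [n] steps away. If the orbits were
       close at time [i], they would be closer at time [j * n] than neighbourhoods of [x] and [y]
       allow. *)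
    set (j := S (i / n)).
    assert (Hdiv := Nat.div_mod i n ltac:(lia)). assert (Hmod := Nat.mod_upper_bound i n ltac:(lia)).
    specialize (Huc (j * n - i)%nat ltac:(unfold j; nia) _ _ Hlt).
    rewrite <- !Nat.iter_add in Huc.
    replace (j * n - i + i)%nat with (j * n)%nat in Huc by (unfold j; nia).
    specialize (Ha j). specialize (Hby j).
    pose proof (metric_tri Hd x (Nat.iter (j * n) f a) y) as T1.
    pose proof (metric_tri Hd (Nat.iter (j * n) f a) (Nat.iter (j * n) f b) y) as T2.
    rewrite (metric_sym Hd x (Nat.iter (j * n) f a)) in T1. lra.
Qed.
End Shadowing.

(** * Upper density one through long runs *)

Definition frequent (P : nat -> Prop) : Prop :=
  forall K N, exists t L, (N <= t)%nat /\ (K * t < L)%nat /\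
    forall i, (i < L)%nat -> P (t + i)%nat.

Lemma frequent_shift (P : nat -> Prop) m : frequent P -> frequent (fun i => P (i + m)%nat).
Proof.
  intros H K N. destruct (H K (N + m)%nat) as [t [L [Ht [HL HP]]]].
  exists (t - m)%nat, L. split; [lia|]. split; [nia|].
  intros i Hi. replace (t - m + i + m)%nat with (t + i)%nat by lia. auto.
Qed.

Lemma frequent_impl (P Q : nat -> Prop) : (forall i, P i -> Q i) -> frequent P -> frequent Q.
Proof.
  intros HPQ H K N. destruct (H K N) as [t [L [Ht [HL HP]]]]. exists t, L. auto.
Qed.

Lemma count_upto_le b n : (count_upto b n <= n)%nat.
Proof. induction n as [|n IH]; simpl; [lia|]. destruct (b n); lia. Qed.

Lemma count_upto_ge b t L : (forall i, (i < L)%nat -> b (t + i)%nat = true) ->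
  (L <= count_upto b (t + L))%nat.
Proof.
  induction L as [|L IH]; intros H; [lia|].
  rewrite Nat.add_succ_r. simpl. rewrite (H L) by lia.
  specialize (IH ltac:(intros i Hi; apply H; lia)). lia.
Qed.

Lemma frequent_limsup (b : nat -> bool) : frequent (fun i => b i = true) ->
  limsup_is_one (fun n => INR (count_upto b n) / INR n).
Proof.
  intros Hb. split; intros eps He.
  (* A run of length [L > K * t] from time [t] occupies more than [K / (K + 1)] of the times before
     its end; [K * eps > 1] makes this exceed [1 - eps]. *)
  - intros N. destruct (INR_archimed eps 1 He) as [K HK].
    destruct (Hb K N) as [t [L [Ht [HL HP]]]].
    exists (t + L)%nat. split; [lia|].
    assert (Hpos : 0 < INR (t + L)) by (apply lt_0_INR; lia).
    apply Rmult_lt_reg_r with (INR (t + L)); [exact Hpos|].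
    unfold Rdiv. rewrite Rmult_assoc, Rinv_l, Rmult_1_r by lra.
    apply Rlt_le_trans with (INR L); [|apply le_INR, count_upto_ge; exact HP].
    apply lt_INR in HL. rewrite mult_INR in HL. rewrite plus_INR in *.
    pose proof (pos_INR t). nra.
  - exists 0%nat. intros n _. destruct n as [|n].
    + simpl. unfold Rdiv. rewrite Rmult_0_l. lra.
    + assert (Hpos : 0 < INR (S n)) by (apply lt_0_INR; lia).
      apply Rmult_lt_reg_r with (INR (S n)); [exact Hpos|].
      unfold Rdiv. rewrite Rmult_assoc, Rinv_l, Rmult_1_r by lra.
      apply Rle_lt_trans with (INR (S n)); [apply le_INR, count_upto_le|]. nra.
Qed.

Lemma Rltb_true a b : Rltb a b = true <-> a < b.
Proof. unfold Rltb. destruct (Rlt_dec a b); split; intros; auto; discriminate. Qed.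

Lemma DC1_pair_of_frequent {X : Type} (d : X -> X -> R) (f : X -> X) x y delta0 :
  (forall delta, 0 < delta -> frequent (fun i => d (Nat.iter i f x) (Nat.iter i f y) < delta)) ->
  0 < delta0 -> frequent (fun i => delta0 < d (Nat.iter i f x) (Nat.iter i f y)) ->
  DC1_pair d f x y.
Proof.
  intros Hclose Hd0 Hfar. split.
  - intros delta Hdel. apply frequent_limsup.
    apply (frequent_impl _ _ (fun i => proj2 (Rltb_true _ _)) (Hclose delta Hdel)).
  - exists delta0. split; [exact Hd0|]. apply frequent_limsup.
    apply (frequent_impl _ _ (fun i => proj2 (Rltb_true _ _)) Hfar).
Qed.

(** * Construction of a scrambled family from a distal linked pair *)

Section Scrambling.

Context {X : Type} (d : X -> X -> R) (f : X -> X).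
Context (Hd : is_metric d) (Hcpt : compact_space d) (Hf : continuous_map d f).

Lemma pseudo_orbit_near_orbit T eps : 0 < eps -> exists eps', 0 < eps' <= eps /\
  forall u, pseudo_orbit d f eps' T u -> d (Nat.iter T f (u 0%nat)) (u T) < eps.
Proof.
  revert eps. induction T as [|T IH]; intros eps He.
  - exists eps. split; [lra|]. intros u _. simpl. rewrite (metric_refl Hd). exact He.
  - destruct (uniformly_continuous Hd Hcpt f Hf (eps / 2)) as [del [Hdel Huc]]; [lra|].
    destruct (IH del Hdel) as [e1 [He1 H1]].
    exists (Rmin e1 (eps / 2)).
    assert (Hp : 0 < Rmin e1 (eps / 2)) by (apply Rmin_glb_lt; lra).
    pose proof (Rmin_l e1 (eps / 2)). pose proof (Rmin_r e1 (eps / 2)).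
    split; [lra|]. intros u Hu. simpl.
    assert (A : d (Nat.iter T f (u 0%nat)) (u T) < del).
    { apply H1. intros i Hi. specialize (Hu i ltac:(lia)). lra. }
    apply Huc in A. specialize (Hu T ltac:(lia)).
    pose proof (metric_tri Hd (f (Nat.iter T f (u 0%nat))) (f (u T)) (u (S T))). lra.
Qed.

Context (a b : X) (Hab : forall eps, 0 < eps -> linked d f eps a b).

(** A sufficiently fine loop, repeated [S T] times to outlast [T], is still near the true orbit at
    time [T]. Replacing its first [T] points by that orbit costs one jump smaller than [eps]. *)
Lemma loops_along_orbits eps T : 0 < eps -> exists n, (T <= n)%nat /\
  forall c, exists u, u 0%nat = pick a b c /\ u n = pick a b c /\ pseudo_orbit d f eps n u /\
    forall i, (i < T)%nat -> u i = Nat.iter i f (pick a b c).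
Proof.
  intros He. destruct (pseudo_orbit_near_orbit T eps He) as [eps' [He' Hnear]].
  destruct (Hab eps') as [n0 [Hn0 Hc]]; [lra|].
  exists (S T * n0)%nat. split; [nia|]. intros c.
  destruct (linked_word d f _ _ _ _ Hc (fun _ => c) (S T)) as [u [Hu Hv]].
  assert (Hu0 : u 0%nat = pick a b c) by (apply (Hv 0%nat); lia).
  assert (Hu1 : u (S T * n0)%nat = pick a b c) by (apply Hv; lia).
  exists (fun i => if lt_dec i T then Nat.iter i f (pick a b c) else u i).
  split; [destruct (lt_dec 0 T); auto|].
  split; [destruct (lt_dec (S T * n0) T); [nia|exact Hu1]|].
  split.
  - intros i Hi. specialize (Hu i Hi) as Hui.
    destruct (lt_dec i T) as [H1|H1], (lt_dec (S i) T) as [H2|H2]; try lia.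
    + simpl. rewrite (metric_refl Hd). exact He.
    + assert (S i = T) as E by lia.
      change (d (Nat.iter (S i) f (pick a b c)) (u (S i)) < eps). rewrite E, <- Hu0.
      apply Hnear. intros j Hj. apply Hu. nia.
    + lra.
  - intros i Hi. destruct (lt_dec i T); [reflexivity|lia].
Qed.

(* Both stretches are longer than [k] times the time elapsed before them, which is what makes the
   upper densities equal to 1. *)
Lemma stage_exists eps k t : 0 < eps -> exists L sigma (W : bool -> nat -> X),
  (sigma + k * (t + sigma) < L)%nat /\ forall c,
    W c 0%nat = a /\ W c L = a /\ pseudo_orbit d f eps L (W c) /\
    (forall i, (i <= k * t)%nat -> W c i = Nat.iter i f a) /\
    (forall i, (i <= k * (t + sigma))%nat -> W c (sigma + i)%nat = Nat.iter i f (pick a b c)).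
Proof.
  intros He.
  destruct (loops_along_orbits eps (S (k * t)) He) as [n1 [Hn1 H1]].
  destruct (H1 false) as [u1 [U0 [U1 [Hu1 U2]]]]. simpl pick in *.
  destruct (Hab eps He) as [m [Hm Hc]].
  destruct (loops_along_orbits eps (S (k * (t + (n1 + m)))) He) as [n2 [Hn2 H2]].
  (* A stage consists of a loop along the orbit of [a], a link to [pick a b c], a loop along its
     orbit and a link back to [a]; the second loop starts at time [sigma]. *)
  set (sigma := (n1 + m)%nat) in *.
  assert (HW : forall c, exists w, w 0%nat = a /\ w (sigma + (n2 + m))%nat = a /\
    pseudo_orbit d f eps (sigma + (n2 + m)) w /\
    (forall i, (i <= k * t)%nat -> w i = Nat.iter i f a) /\
    (forall i, (i <= k * (t + sigma))%nat -> w (sigma + i)%nat = Nat.iter i f (pick a b c))).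
  { intros c.
    destruct (Hc false c) as [v1 [V0 [V1 Hv1]]]. destruct (Hc c false) as [v2 [V0' [V1' Hv2]]].
    destruct (H2 c) as [u2 [U0' [U1' [Hu2 U2']]]]. simpl pick in V0, V1'.
    assert (E1 : u1 n1 = v1 0%nat) by congruence.
    assert (E2 : u2 n2 = v2 0%nat) by congruence.
    set (l := splice n1 u1 v1). set (r := splice n2 u2 v2).
    assert (Er : r 0%nat = u2 0%nat) by (apply splice_l'; [exact E2|lia]).
    assert (E3 : l sigma = r 0%nat) by (unfold l, sigma; rewrite splice_r, Er; congruence).
    assert (El : forall i, (i <= n1)%nat -> l i = u1 i) by (intros i Hi; apply splice_l'; auto).
    exists (splice sigma l r). split; [|split; [|split; [|split]]].
    - rewrite splice_l', El by (auto; lia). exact U0.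
    - rewrite splice_r. unfold r. rewrite splice_r. exact V1'.
    - apply pseudo_orbit_splice; [|exact E3|]; apply pseudo_orbit_splice; assumption.
    - intros i Hi. rewrite splice_l', El by (auto; unfold sigma; lia). apply U2. lia.
    - intros i Hi. rewrite splice_r. unfold r. rewrite splice_l' by (auto; lia). apply U2'. lia. }
  destruct (functional_choice _ HW) as [W HW'].
  exists (sigma + (n2 + m))%nat, sigma, W. split; [lia|exact HW'].
Qed.

Context (Hls : limit_shadowing d f) (delta : R) (Hdelta : 0 < delta).
Context (Hfar : forall i, delta <= d (Nat.iter i f a) (Nat.iter i f b)).

(* Stage [k] uses the symbol [s (k - (sqrt k)^2)], so that each symbol is used infinitely often. *)
Lemma scrambled_family : exists Z : (nat -> bool) -> X, forall s s',
  (forall eps, 0 < eps -> frequent (fun i => d (Nat.iter i f (Z s)) (Nat.iter i f (Z s')) < eps)) /\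
  forall n, s n = false -> s' n = true ->
    frequent (fun i => delta / 2 < d (Nat.iter i f (Z s)) (Nat.iter i f (Z s'))) /\
    forall eps, 0 < eps -> exists t, d a (Nat.iter t f (Z s)) < eps /\ d b (Nat.iter t f (Z s')) < eps.
Proof.
  assert (Hst : forall kt : nat * nat, exists P : nat * nat * (bool -> nat -> X),
    let k := fst kt in let t := snd kt in
    let L := fst (fst P) in let sigma := snd (fst P) in let W := snd P in
    (sigma + k * (t + sigma) < L)%nat /\ forall c,
    W c 0%nat = a /\ W c L = a /\ pseudo_orbit d f (/ INR (S k)) L (W c) /\
    (forall i, (i <= k * t)%nat -> W c i = Nat.iter i f a) /\
    (forall i, (i <= k * (t + sigma))%nat -> W c (sigma + i)%nat = Nat.iter i f (pick a b c))).
  { intros [k t]. destruct (stage_exists _ k t (inv_INR_S_pos k)) as [L [sigma [W H]]].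
    exists (L, sigma, W). exact H. }
  destruct (functional_choice _ Hst) as [P HP]. cbv zeta in HP.
  (* The recursion is needed because the length of stage [k] depends on the time [T k] elapsed
     before it. *)
  pose (T := nat_rect (fun _ => nat) 0%nat (fun k t => (t + fst (fst (P (k, t))))%nat)).
  set (L := fun k => fst (fst (P (k, T k)))). set (sigma := fun k => snd (fst (P (k, T k)))).
  set (W := fun k => snd (P (k, T k))).
  assert (HTS : forall k, T (S k) = (T k + L k)%nat) by reflexivity.
  assert (HL : forall k, (T (S k) - T k)%nat = L k) by (intros k; rewrite HTS; lia).
  assert (HL0 : forall k, (sigma k + k * (T k + sigma k) < L k)%nat)
    by (intros k; apply (HP (k, T k))).
  assert (HTge : forall k, (k <= T k)%nat).
  { induction k as [|k IH]; [lia|]. rewrite HTS. specialize (HL0 k). lia. }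
  set (phi := fun k => (k - Nat.sqrt k * Nat.sqrt k)%nat).
  assert (Hphi : forall n N, exists k, (N <= k)%nat /\ phi k = n).
  (* The square root of this number is [n + N], as [n] is at most [2 * (n + N)]; the remainder is
     [n]. *)
  { intros n N. exists (n + (n + N) * (n + N))%nat. split; [nia|]. unfold phi.
    rewrite (Nat.sqrt_unique _ (n + N)%nat); nia. }
  assert (HZ : forall s : nat -> bool, exists z, forall eps, 0 < eps -> exists M, forall k i,
    (M <= k)%nat -> (i <= L k)%nat -> d (Nat.iter (T k + i) f z) (W k (s (phi k)) i) < eps).
  { intros s.
    destruct (shadow_concatenation d f Hd Hls T (fun k => W k (s (phi k))) a) as [z Hz].
    - reflexivity.
    - intros k. rewrite HTS. specialize (HL0 k). lia.
    - intros k. exact (proj1 (proj2 (HP (k, T k)) (s (phi k)))).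
    - intros k. rewrite HL. exact (proj1 (proj2 (proj2 (HP (k, T k)) (s (phi k))))).
    - intros k. rewrite HL. exact (proj1 (proj2 (proj2 (proj2 (HP (k, T k)) (s (phi k)))))).
    - exists z. intros eps He. destruct (Hz eps He) as [M HM]. exists M.
      intros k i. rewrite <- HL. apply HM. }
  destruct (functional_choice _ HZ) as [Z HZ']. exists Z. intros s s'.
  assert (Hboth : forall eps N, 0 < eps -> exists M, (N <= M)%nat /\ forall k i,
    (M <= k)%nat -> (i <= L k)%nat ->
    d (Nat.iter (T k + i) f (Z s)) (W k (s (phi k)) i) < eps /\
    d (Nat.iter (T k + i) f (Z s')) (W k (s' (phi k)) i) < eps).
  { intros eps N He. destruct (HZ' s eps He) as [M1 HM1]. destruct (HZ' s' eps He) as [M2 HM2].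
    exists (Nat.max N (Nat.max M1 M2)). split; [lia|].
    intros k i Hk Hi. split; [apply HM1|apply HM2]; lia. }
  split.
  - intros eps He K N.
    (* A stage index of at least [K] makes the common stretch along the orbit of [a] longer than [K]
       times its starting time. *)
    destruct (Hboth (eps / 2) (Nat.max K N)) as [M [HM Hs]]; [lra|].
    exists (T M), (S (M * T M)). split; [specialize (HTge M); lia|]. split; [nia|].
    intros i Hi. destruct (Hs M i (le_n M)) as [S1 S2]; [specialize (HL0 M); nia|].
    assert (E : forall c, W M c i = Nat.iter i f a).
    { intros c. destruct (HP (M, T M)) as [_ HPM]. apply (HPM c). simpl. lia. }
    rewrite E in S1, S2.
    pose proof (metric_tri Hd (Nat.iter (T M + i) f (Z s)) (Nat.iter i f a) (Nat.iter (T M + i) f (Z s'))).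
    rewrite (metric_sym Hd (Nat.iter i f a)) in H. lra.
  - intros n Hn Hn'.
    assert (Hmain : forall eps N, 0 < eps -> exists k, (N <= k)%nat /\
      forall i, (i <= k * (T k + sigma k))%nat ->
      d (Nat.iter (T k + sigma k + i) f (Z s)) (Nat.iter i f a) < eps /\
      d (Nat.iter (T k + sigma k + i) f (Z s')) (Nat.iter i f b) < eps).
    { intros eps N He. destruct (Hboth eps N He) as [M [HM Hs]].
      destruct (Hphi n M) as [k [Hk Hkn]]. exists k. split; [lia|]. intros i Hi.
      specialize (Hs k (sigma k + i)%nat Hk). specialize (HL0 k).
      rewrite Hkn, Hn, Hn', Nat.add_assoc in Hs.
      destruct (HP (k, T k)) as [_ HPk].
      unfold W, sigma in Hs. unfold sigma in Hi.
      rewrite (proj2 (proj2 (proj2 (proj2 (HPk false))))) in Hs by exact Hi.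
      rewrite (proj2 (proj2 (proj2 (proj2 (HPk true))))) in Hs by exact Hi.
      apply Hs. unfold sigma in HL0. lia. }
    split.
    (* Two shadowing errors below [delta / 4] leave more than [delta / 2] of the separation
       [delta]. *)
    + intros K N. destruct (Hmain (delta / 4) (Nat.max K N)) as [k [Hk Hs]]; [lra|].
      exists (T k + sigma k)%nat, (S (k * (T k + sigma k))).
      split; [specialize (HTge k); lia|]. split; [nia|].
      intros i Hi. destruct (Hs i) as [S1 S2]; [lia|]. specialize (Hfar i).
      set (p := Nat.iter (T k + sigma k + i) f (Z s)) in *.
      set (q := Nat.iter (T k + sigma k + i) f (Z s')) in *.
      pose proof (metric_tri Hd (Nat.iter i f a) p (Nat.iter i f b)).
      pose proof (metric_tri Hd p q (Nat.iter i f b)).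
      rewrite (metric_sym Hd (Nat.iter i f a) p) in H. lra.
    + intros eps He. destruct (Hmain eps 0%nat He) as [k [_ Hs]].
      exists (T k + sigma k)%nat. specialize (Hs 0%nat ltac:(lia)). simpl in Hs.
      rewrite Nat.add_0_r in Hs. rewrite (metric_sym Hd a), (metric_sym Hd b). exact Hs.
Qed.

End Scrambling.

(** * Uncountability and the two conclusions *)

Lemma no_injection_from_cantor_space (h : (nat -> bool) -> nat) :
  exists s s' n, h s = h s' /\ s n = false /\ s' n = true.
Proof.
  apply NNPP. intros Hno.
  assert (H : forall n, exists c : bool, c = true <-> ~ exists s, h s = n /\ s n = true).
  { intros n. destruct (classic (exists s, h s = n /\ s n = true)) as [Hs|Hs].
    - exists false. split; [discriminate|tauto].
    - exists true. tauto. }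
  (* Diagonal argument: [s n] is true exactly when no sequence with code [n] is true at [n]. So [s]
     is false at its own code, which produces another sequence with that code that is true there. *)
  destruct (functional_choice _ H) as [s Hs]. specialize (Hs (h s)).
  destruct (s (h s)) eqn:E.
  - apply (proj1 Hs eq_refl). eauto.
  - assert (Hs' : exists s', h s' = h s /\ s' (h s) = true).
    { apply NNPP. intros Hn. discriminate (proj2 Hs Hn). }
    destruct Hs' as [s' [H1 H2]]. apply Hno. exists s, s', (h s). auto.
Qed.

Theorem theorem1p2 (X : Type) (d : X -> X -> R) (f : X -> X)
  (Hd : is_metric d) (Hcpt : compact_space d) (Hf : continuous_map d f)
  (Hls : limit_shadowing d f) (Hent : htop_pos d f) :
  exhibits_DC1 d f /\
  (forall x y, entropy_pair d f x y -> in_closure_DC1 d f x y).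
Proof.
  split.
  - destruct (positive_entropy_linked_pair d f Hd Hcpt Hf Hent) as [x [y [Hne Hxy]]].
    destruct (linked_distal_pair d f Hd Hls Hcpt Hf x y Hne Hxy 1 Rlt_0_1)
      as [a [b [delta [_ [_ [Hab [Hdel Hfar]]]]]]].
    destruct (scrambled_family d f Hd Hcpt Hf a b Hab Hls delta Hdel Hfar) as [Z HZ].
    exists (fun z => exists s, z = Z s). split.
    + intros [g Hg].
      (* Two sequences with the same code give the same point, although they differ at [n], where
         the construction forces distance above [delta / 2] at some time. *)
      destruct (no_injection_from_cantor_space (fun s => g (Z s))) as [s [s' [n [E [Hn Hn']]]]].
      apply Hg in E; [|eauto|eauto].
      destruct (proj2 (HZ s s') n Hn Hn') as [Hfr _].
      destruct (Hfr 0%nat 0%nat) as [t [L [_ [HL Hlt]]]]. specialize (Hlt 0%nat HL).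
      rewrite E, (metric_refl Hd) in Hlt. lra.
    + intros p q [s ->] [s' ->] Hpq.
      assert (Hn : exists n, s n <> s' n).
      { apply NNPP. intros Hn. apply Hpq. f_equal. apply functional_extensionality.
        intros n. apply NNPP. eauto. }
      destruct Hn as [n Hn].
      apply DC1_pair_of_frequent with (delta / 2); [apply HZ|lra|].
      destruct (s n) eqn:E, (s' n) eqn:E'; try congruence.
      * destruct (proj2 (HZ s' s) n E' E) as [Hfr _]. revert Hfr.
        apply frequent_impl. intros i. rewrite (metric_sym Hd). auto.
      * apply (proj2 (HZ s s') n E E').
  - intros x y Hxy eps He.
    destruct (linked_distal_pair d f Hd Hls Hcpt Hf x y (proj1 Hxy)
      (entropy_pair_linked d f Hd Hcpt Hf x y Hxy) (eps / 2))
      as [a [b [delta [Ha [Hb [Hab [Hdel Hfar]]]]]]]; [lra|].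
    destruct (scrambled_family d f Hd Hcpt Hf a b Hab Hls delta Hdel Hfar) as [Z HZ].
    (* The constant sequences provide a time [t] at which the two orbits are near [a] and [b]. The
       points at that time still form a DC1 pair, since [frequent] survives the shift by [t]. *)
    set (s := fun _ : nat => false). set (s' := fun _ : nat => true).
    destruct (HZ s s') as [Hclose Hrest].
    destruct (Hrest 0%nat eq_refl eq_refl) as [Hfr Hvisit].
    destruct (Hvisit (eps / 2)) as [t [Hta Htb]]; [lra|].
    exists (Nat.iter t f (Z s)), (Nat.iter t f (Z s')). split; [|split].
    + apply DC1_pair_of_frequent with (delta / 2); [|lra|].
      * intros eta Heta. generalize (frequent_shift _ t (Hclose eta Heta)).
        apply frequent_impl. intros i. rewrite !Nat.iter_add. auto.
      * generalize (frequent_shift _ t Hfr).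
        apply frequent_impl. intros i. rewrite !Nat.iter_add. auto.
    + pose proof (metric_tri Hd x a (Nat.iter t f (Z s))). rewrite (metric_sym Hd x a) in H. lra.
    + pose proof (metric_tri Hd y b (Nat.iter t f (Z s'))). rewrite (metric_sym Hd y b) in H. lra.
Qed.
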